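(* Let $\mathcal{H}$ be a complex Hilbert space, let $A\in\mathcal{B}(\mathcal{H})$ be a nonzero positive semidefinite operator, and let $T\in\mathcal{B}_{A^{1/2}}(\mathcal{H})$ satisfy $dw_A(T)=\|T\|_A^2$. Then: (i) if $M_T^A\neq\emptyset$, then $|\langle Tx,x\rangle_A|=0$ for every $x\in M_T^A$, i.e. $M_T^A\subseteq c_T^A$; (ii) if $M_T^A=\emptyset$, then there exists a sequence $\{x_n\}$ in $\mathcal{H}$ with $\|x_n\|_A=1$ for all $n$ such that $\lim_{n\to\infty}\|Tx_n\|_A=\|T\|_A$ and $\lim_{n\to\infty}|\langle Tx_n,x_n\rangle_A|=0$.
   Context: $\mathcal{B}(\mathcal{H})$ is the algebra of bounded linear operators on the complex Hilbert space $\mathcal{H}$. For a positive semidefinite $A\in\mathcal{B}(\mathcal{H})$ (i.e. $\langle Ax,x\rangle\ge 0$ for all $x$), put $\langle x,y\rangle_A=\langle Ax,y\rangle$ and $\|x\|_A=\sqrt{\langle x,x\rangle_A}$. $\mathcal{B}_{A^{1/2}}(\mathcal{H})$ is the set of $T\in\mathcal{B}(\mathcal{H})$ that are $A$-bounded: there is $c>0$ with $\|Tx\|_A\le c\|x\|_A$ for all $x\in\mathcal{H}$. For $T\in\mathcal{B}_{A^{1/2}}(\mathcal{H})$: $\|T\|_A=\sup\{\|Tx\|_A: x\in\mathcal{H},\|x\|_A=1\}$; the $A$-Crawford number is $c_A(T)=\inf\{|\langle Tx,x\rangle_A|: x\in\mathcal{H},\|x\|_A=1\}$; the $A$-Davis-Wielandt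 radius is $dw_A(T)=\sup\{\sqrt{|\langle Tx,x\rangle_A|^2+\|Tx\|_A^4}: x\in\mathcal{H},\|x\|_A=1\}$. The attainment sets are $M_T^A=\{x\in\mathcal{H}: \|x\|_A=1,\ \|Tx\|_A=\|T\|_A\}$ and $c_T^A=\{x\in\mathcal{H}: \|x\|_A=1,\ |\langle Tx,x\rangle_A|=c_A(T)\}$. *)

(* Defs.v *)
From HB Require Import structures.
From mathcomp Require Import all_boot all_order all_algebra.
From mathcomp Require Import complex.
From mathcomp Require Import all_classical all_reals all_analysis.

Set Implicit Arguments.
Unset Strict Implicit.
Unset Printing Implicit Defensive.

Import Order.TTheory GRing.Theory Num.Theory Num.Def.
Import numFieldNormedType.Exports.

Local Open Scope classical_set_scope.
Local Open Scope ring_scope.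

(* A complex Hilbert space is a complete normed space [H] over [R[i]] with a
   positive definite Hermitian form [dot] (linear in the first variable,
   conjugate-linear in the second) inducing the norm of [H]. *)
Definition induces_norm (R : realType) (H : completeNormedModType R[i])
    (dot : {dot H for conjC}) : Prop :=
  forall x : H, `|x| ^+ 2 = dot x x.

Definition bounded_operator (R : realType) (H : completeNormedModType R[i])
    (T : {linear H -> H}) : Prop :=
  exists c : R, forall x : H, `|T x| <= real_complex R c * `|x|.

(* [0 <= z] in [R[i]] says that [z] is real and nonnegative. *)
Definition positive_semidefinite (R : realType)
    (H : completeNormedModType R[i]) (dot : {dot H for conjC})
    (A : {linear H -> H}) : Prop :=
  forall x : H, 0 <= dot (A x) x.

(* The norm of [R[i]] takes values in [R[i]]; this is the modulus in [R]. *)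
Definition cmod (R : realType) (z : R[i]) : R := complex.Re `|z|.

Section SemiInner.
Variables (R : realType) (H : completeNormedModType R[i]).
Variables (dot : {dot H for conjC}) (A T : {linear H -> H}).

Definition dotA (x y : H) : R[i] := dot (A x) y.

Definition normA (x : H) : R := Num.sqrt (complex.Re (dotA x x)).

Definition unitA : set H := [set x | normA x = 1].

Definition A_bounded : Prop :=
  exists2 c : R, 0 < c & forall x : H, normA (T x) <= c * normA x.

Definition opnormA : R := sup [set normA (T x) | x in unitA].

Definition crawfordA : R := inf [set cmod (dotA (T x) x) | x in unitA].

Definition dwA : R :=
  sup [set Num.sqrt (cmod (dotA (T x) x) ^+ 2 + normA (T x) ^+ 4)
      | x in unitA].

Definition norm_attainA : set H :=
  [set x | normA x = 1 /\ normA (T x) = opnormA].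

Definition crawford_attainA : set H :=
  [set x | normA x = 1 /\ cmod (dotA (T x) x) = crawfordA].

End SemiInner.

(* Main.v *)
(** When [dwA = opnormA ^+ 2], every [A]-unit vector [x] satisfies
    [cmod (dotA (T x) x) ^+ 2 <= opnormA ^+ 4 - normA (T x) ^+ 4]; the right-hand
    side vanishes on the attainment set and tends to [0] along any maximizing
    sequence. Since Rocq's [sup] is [0] on empty or unbounded sets, this first
    requires that [A]-unit vectors exist and that the set defining [dwA] is
    bounded. *)
Require Import Defs.
From HB Require Import structures.
From mathcomp Require Import all_boot all_order all_algebra.
From mathcomp Require Import complex.
From mathcomp Require Import all_classical all_reals all_analysis.
From mathcomp Require Import ring lra.

Import Order.TTheory GRing.Theory Num.Theory Num.Def.
Import numFieldNormedType.Exports.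

Local Open Scope classical_set_scope.
Local Open Scope ring_scope.

Section SemiInnerTheory.
Context {R : realType} {H : completeNormedModType R[i]}.
Context {dot : {dot H for conjC}} {A : {linear H -> H}}.
Implicit Types (u v w : H) (a : R[i]).

Lemma dotADl u v w : dotA dot A (u + v) w = dotA dot A u w + dotA dot A v w.
Proof. by rewrite /dotA linearD linearDl. Qed.

Lemma dotADr u v w : dotA dot A u (v + w) = dotA dot A u v + dotA dot A u w.
Proof. exact: linearDr. Qed.

Lemma dotANl u v : dotA dot A (- u) v = - dotA dot A u v.
Proof. by rewrite /dotA linearN linearNl. Qed.

Lemma dotANr u v : dotA dot A u (- v) = - dotA dot A u v.
Proof. exact: linearNr. Qed.

Lemma dotAZl a u v : dotA dot A (a *: u) v = a * dotA dot A u v.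
Proof. by rewrite /dotA linearZ; exact: linearZl_LR. Qed.

Lemma dotAZr a u v : dotA dot A u (a *: v) = conjC a * dotA dot A u v.
Proof. exact: linearZr_LR. Qed.

Definition dotAE := (dotADl, dotADr, dotANl, dotANr, dotAZl, dotAZr).

Lemma dotA_Ci v : dotA dot A ('i *: v) ('i *: v) = dotA dot A v v.
Proof. by rewrite !dotAE conjCi mulrA mulrN -expr2 sqrCi opprK mul1r. Qed.

Lemma dotA_parallelogram u v :
  dotA dot A (u + v) (u + v) + dotA dot A (u - v) (u - v) =
  2 * (dotA dot A u u + dotA dot A v v).
Proof. by rewrite !dotAE; ring. Qed.

Lemma dotA_polarization u v :
  4 * dotA dot A u v =
    dotA dot A (u + v) (u + v) - dotA dot A (u - v) (u - v)
    + 'i * (dotA dot A (u + 'i *: v) (u + 'i *: v)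
            - dotA dot A (u - 'i *: v) (u - 'i *: v)).
Proof.
have ii : 'i * 'i = -1 :> R[i] by rewrite -expr2 sqrCi.
by rewrite !dotAE conjCi; ring: ii.
Qed.

Hypothesis psdA : positive_semidefinite dot A.

(* Polarization suffices for this weak form of Cauchy-Schwarz, and it needs no
   self-adjointness of [A]. *)
Lemma norm_dotA_le u v :
  `|dotA dot A u v| <= dotA dot A u u + dotA dot A v v.
Proof.
have q0 w : 0 <= dotA dot A w w by exact: psdA.
have P := dotA_parallelogram u v.
have := dotA_parallelogram u ('i *: v); rewrite dotA_Ci => Pi.
(* The triangle inequality bounds the polarization sum by the four nonnegative values of the form at
   [u + v], [u - v], [u + 'i *: v] and [u - 'i *: v]. The parallelogram laws [P] and [Pi] evaluate
   each pair, which gives the total factor 2 + 2 = 4. *)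
have : 4 * `|dotA dot A u v| <= 4 * (dotA dot A u u + dotA dot A v v).
  rewrite -[4 in X in X <= _]normr_nat -normrM dotA_polarization.
  apply: (le_trans (ler_normD _ _)); rewrite normrM normCi mul1r.
  apply: (le_trans (lerD (ler_normB _ _) (ler_normB _ _))).
  by rewrite !ger0_norm// P Pi -mulrDl -natrD.
by rewrite ler_pM2l// ltr0n.
Qed.

(** Nonnegativity in [R[i]] kills the imaginary part and makes the real part nonnegative, so neither
    [complex.Re] nor [Num.sqrt], which sends negatives to 0, loses information. *)
Lemma dotA_normA u : dotA dot A u u = (normA dot A u ^+ 2)%:C%C.
Proof.
have := psdA u; rewrite -/(dotA dot A u u) /normA.
case: (dotA dot A u u) => a b; rewrite lecE/= => /andP[/eqP -> a0].
by rewrite sqr_sqrtr.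
Qed.

Lemma cmod_dotA_le u v :
  cmod (dotA dot A u v) <= normA dot A u ^+ 2 + normA dot A v ^+ 2.
Proof.
have := norm_dotA_le u v; rewrite !dotA_normA lecE/= => /andP[_].
by rewrite /cmod.
Qed.

Lemma normA_ge0 u : 0 <= normA dot A u.
Proof. exact: sqrtr_ge0. Qed.

Lemma cmod_ge0 (z : R[i]) : 0 <= cmod z.
Proof. by have := normr_ge0 z; rewrite lecE => /andP[]. Qed.

Lemma normAZ (r : R) u : 0 <= r -> normA dot A (r%:C%C *: u) = r * normA dot A u.
Proof.
move=> r0; apply/eqP; rewrite -(@eqrXn2 _ 2)// ?mulr_ge0 ?normA_ge0//.
apply/eqP/complexI; rewrite exprMn -dotA_normA !dotAE dotA_normA.
have -> : conjC r%:C%C = r%:C%C by exact: conjc_real.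
by rewrite mulrA !rmorphM.
Qed.

(** If [normA] vanished identically, the weak Cauchy-Schwarz bound at [x] and [A x] would force
    [dot (A x) (A x) = 0], hence [A x = 0]. So some vector has nonzero [normA] and can be
    normalized. *)
Lemma unitA_nonempty : induces_norm dot -> (exists x, A x != 0) ->
  unitA dot A !=set0.
Proof.
move=> hdot [x Ax0].
have [w w0] : exists w, normA dot A w != 0.
  apply: contrapT => /forallNP q0; move/eqP: Ax0; apply.
  have qE w : dotA dot A w w = 0.
    by rewrite dotA_normA; have /negP/negPn/eqP -> := q0 w; rewrite expr0n.
  have := norm_dotA_le x (A x); rewrite !qE addr0 normr_le0 /dotA -hdot.
  by rewrite sqrf_eq0 normr_eq0 => /eqP.
exists ((normA dot A w)^-1%:C%C *: w) => /=.
by rewrite /unitA /= normAZ ?invr_ge0 ?normA_ge0// mulVf.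
Qed.

Context {T : {linear H -> H}}.
Hypothesis AbT : A_bounded dot A T.

Lemma normA_le_opnormA x : unitA dot A x -> normA dot A (T x) <= opnormA dot A T.
Proof.
have [c c0 hc] := AbT.
move=> x1; apply: ub_le_sup; last by exists x.
by exists c => _ [y y1 <-]; rewrite (le_trans (hc y))// y1 mulr1.
Qed.

Lemma le_dwA x : unitA dot A x ->
  Num.sqrt (cmod (dotA dot A (T x) x) ^+ 2 + normA dot A (T x) ^+ 4)
    <= dwA dot A T.
Proof.
have [c c0 hc] := AbT.
move=> x1; apply: ub_le_sup; last by exists x.
(* On unit vectors [normA (T y) <= c], and [cmod_dotA_le] then bounds the modulus by
   [c ^+ 2 + 1]. *)
exists (Num.sqrt ((c ^+ 2 + 1) ^+ 2 + c ^+ 4)) => _ [y y1 <-].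
have Tyc : normA dot A (T y) <= c by rewrite (le_trans (hc y))// y1 mulr1.
apply: ler_wsqrtr; apply: lerD; apply: lerXn2r; rewrite ?nnegrE//.
- exact: cmod_ge0.
- by rewrite addr_ge0 ?sqr_ge0.
- apply: (le_trans (cmod_dotA_le _ _)); rewrite y1 expr1n lerD2r.
  by apply: lerXn2r; rewrite ?nnegrE// ?normA_ge0// ltW.
- exact: normA_ge0.
- exact: ltW.
Qed.

Hypothesis hdw : dwA dot A T = opnormA dot A T ^+ 2.

Lemma cmod_dotA_sqr_le x : unitA dot A x ->
  cmod (dotA dot A (T x) x) ^+ 2 <= opnormA dot A T ^+ 4 - normA dot A (T x) ^+ 4.
Proof.
move=> x1; have := le_dwA x x1; rewrite hdw => h.
have -> : opnormA dot A T ^+ 4 = (opnormA dot A T ^+ 2) ^+ 2 by rewrite -exprM.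
by rewrite lerBrDr -ler_sqrt ?sqr_ge0// sqrtr_sqr ger0_norm ?sqr_ge0.
Qed.

End SemiInnerTheory.

Theorem theorem2p4 (R : realType) (H : completeNormedModType R[i])
    (dot : {dot H for conjC}) (hdot : induces_norm dot)
    (A : {linear H -> H}) (bA : bounded_operator A)
    (A0 : exists x : H, A x != 0) (psdA : positive_semidefinite dot A)
    (T : {linear H -> H}) (bT : bounded_operator T) (AbT : A_bounded dot A T)
    (hdw : dwA dot A T = opnormA dot A T ^+ 2) :
  (norm_attainA dot A T !=set0 ->
     (forall x : H, norm_attainA dot A T x -> cmod (dotA dot A (T x) x) = 0) /\
     norm_attainA dot A T `<=` crawford_attainA dot A T) /\
  (norm_attainA dot A T = set0 ->
     exists x : nat -> H,
       [/\ forall n : nat, normA dot A (x n) = 1,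
           (fun n : nat => normA dot A (T (x n))) @ \oo --> opnormA dot A T &
           (fun n : nat => cmod (dotA dot A (T (x n)) (x n))) @ \oo
             --> (0 : R)]).
Proof.
have bound := cmod_dotA_sqr_le psdA AbT hdw.
split=> [_|_].
  have c0 x : norm_attainA dot A T x -> cmod (dotA dot A (T x) x) = 0.
    move=> [x1 xN]; apply/eqP; rewrite -sqrf_eq0; apply/eqP/le_anti.
    by have := bound x x1; rewrite xN subrr sqr_ge0 andbT.
  split=> // x Mx; split; first by case: Mx.
  (* The Crawford number is 0: all moduli are nonnegative, and [x] itself contributes the value 0 to
     the infimum. *)
  rewrite c0//; apply: le_anti; apply/andP; split.
    apply: lb_le_inf; last by move=> _ [y _ <-]; exact: cmod_ge0.
    by exists (cmod (dotA dot A (T x) x)), x => //; case: Mx.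
  rewrite -[leRHS](c0 x Mx); apply: ge_inf; last by exists x => //; case: Mx.
  by exists 0 => _ [y _ <-]; exact: cmod_ge0.
have [x0 x01] := unitA_nonempty psdA hdot A0.
(* [harmonic n] is [1 / (n + 1)], positive already at [n = 0], so [opnormA - harmonic n] lies
   strictly below the supremum for every [n]. *)
have near_sup n : exists y, unitA dot A y /\
    opnormA dot A T - harmonic n < normA dot A (T y).
  have [||_ [y y1 <-] hy] := @sup_gt R [set normA dot A (T y) | y in unitA dot A]
      (opnormA dot A T - harmonic n); last by exists y.
  - by exists (normA dot A (T x0)), x0.
  - by rewrite ltrBlDr ltrDl invr_gt0 ltr0n.
have [x hx] := choice near_sup.
have x1 n : normA dot A (x n) = 1 by case: (hx n).
have cvgT : (fun n => normA dot A (T (x n))) @ \oo --> opnormA dot A T.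
  apply: (@squeeze_cvgr _ _ _ _ (fun n => opnormA dot A T - harmonic n)
    (fun=> opnormA dot A T)).
  - near=> n; rewrite ltW ?(hx n).2//=.
    exact: (normA_le_opnormA AbT _ (x1 n)).
  - rewrite -[X in _ --> X]subr0; apply: cvgB; first exact: cvg_cst.
    exact: cvg_harmonic.
  - exact: cvg_cst.
exists x; split=> //.
(* The upper envelope is the square root of the estimate [bound]. *)
apply: (@squeeze_cvgr _ _ _ _ (fun=> 0)
  (fun n => Num.sqrt (opnormA dot A T ^+ 4 - normA dot A (T (x n)) ^+ 4))).
- near=> n; rewrite cmod_ge0/= -[leLHS]ger0_norm ?cmod_ge0// -sqrtr_sqr.
  by apply: ler_wsqrtr; apply: bound.
- exact: cvg_cst.
(* Writing the limit 0 as the root of [opnormA ^+ 4 - opnormA ^+ 4] reduces the claim to [cvgT] and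
   the continuity of root and fourth power. *)
rewrite -[X in _ --> X](@sqrtr0 R) -(subrr (opnormA dot A T ^+ 4)).
apply: (continuous_cvg _ (@sqrt_continuous R _)).
apply: cvgB; first exact: cvg_cst.
exact: (cvg_comp _ _ cvgT (@exprn_continuous R 4 _)).
Unshelve. all: by end_near.
Qed.
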